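(* Let $A$ be a set and let $\ast\colon A\times A\to A$ be a binary operation on $A$. Then $\ast$ extends to a totally associative product on $A$ (that is, there exists a totally associative product $P$ on $A$ such that $P(a,b)=a\ast b$ for all $a,b\in A$) if and only if $\ast$ is associative (that is, $(a\ast b)\ast c=a\ast(b\ast c)$ for all $a,b,c\in A$) and admits an identity element (that is, there exists $e\in A$ such that $e\ast a=a=a\ast e$ for all $a\in A$).
   Context: Finite sequences are allowed to have any length $n\ge 0$; in particular, the empty sequence (length $0$) and sequences of length $1$ are included. A product on a set $A$ is a rule $P$ that assigns to each finite sequence $(a_1,\ldots,a_n)$ of elements of $A$ (with $n\ge 0$) an element $P(a_1,\ldots,a_n)\in A$, such that the product of a $1$-term sequence is its term: $P(a)=a$ for all $a\in A$. A product $P$ on $A$ is totally associative if each finite product of finite products equals the product of the concatenated sequence: for every $k\ge 0$ and all finite sequences $s_1,\ldots,s_k$ of elements of $A$ (each of any length $\ge 0$), one has $P(P(s_1),\ldots,P(s_k))=P(s_1 s_2\cdots s_k)$, where $s_1 s_2\cdots s_k$ denotes the concatenation of the sequences. For example, $(abc)d(ef)$ must equal the $6$-term product $abcdef$. *)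

(* Defs.v *)
From mathcomp Require Import all_boot.

Set Implicit Arguments.
Unset Strict Implicit.
Unset Printing Implicit Defensive.

(* A finite sequence of elements of [A], of any length including 0, is an
   element of [seq A]. *)
Definition is_product (A : Type) (P : seq A -> A) : Prop :=
  forall a : A, P [:: a] = a.

(* [ss] is the list of factors s_1, ..., s_k; both [ss] and its members may be
   empty. *)
Definition totally_associative (A : Type) (P : seq A -> A) : Prop :=
  forall ss : seq (seq A), P [seq P s | s <- ss] = P (flatten ss).

Definition extends (A : Type) (P : seq A -> A) (op : A -> A -> A) : Prop :=
  forall a b : A, P [:: a; b] = op a b.

(* Main.v *)
(* A totally associative product multiplies the empty sequence to an identity;
   conversely, the right-nested product ending in the identity is totally
   associative. *)
Require Import Defs.
From mathcomp Require Import all_boot.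

(** Total associativity with two factors makes [P] a morphism from [seq A] under concatenation to
    [op]. It is onto since [P [:: a] = a], so the monoid laws of concatenation pass to [op].
    Conversely, in a monoid [foldr op e] is such a morphism. *)

Lemma foldr_op_cat (A : Type) (op : A -> A -> A) (e : A) :
  associative op -> left_id e op ->
  {morph foldr op e : s t / s ++ t >-> op s t}.
Proof. by move=> opA op1x s t; elim: s => [|x s IHs] /=; rewrite ?op1x // IHs opA. Qed.

Lemma foldr_totally_associative (A : Type) (op : A -> A -> A) (e : A) :
  associative op -> left_id e op -> totally_associative (foldr op e).
Proof.
by move=> opA op1x; elim=> //= s ss IHss; rewrite foldr_op_cat // -IHss.
Qed.

Lemma totally_associative_cat (A : Type) (P : seq A -> A) (op : A -> A -> A) :
  totally_associative P -> extends P op ->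
  {morph P : s t / s ++ t >-> op s t}.
Proof. by move=> PA Pop s t; rewrite -Pop (PA [:: s; t]) /= cats0. Qed.

Theorem mainTheorem1 (A : Type) (op : A -> A -> A) :
  (exists P : seq A -> A,
      [/\ is_product P, totally_associative P & extends P op])
  <->
  (associative op /\ exists e : A, left_id e op /\ right_id e op).
Proof.
split=> [[P [P1 PA Pop]] | [opA [e [op1x opx1]]]].
  have Pcat := totally_associative_cat _ _ _ PA Pop.
  split=> [a b c|].
    (* Both sides become [P] of the same three-term sequence. *)
    by rewrite -(P1 a) -(P1 b) -(P1 c) -!Pcat.
  by exists (P [::]); split=> a; rewrite -(P1 a) -Pcat.
exists (foldr op e); split.
(* The goal is [op a e = a], closed by [opx1]. *)
- by move=> a /=.
- exact: foldr_totally_associative.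
- by move=> a b /=; rewrite opx1.
Qed.
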